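(* Let $\nu$ be a closed coinductive type and $v$ a size variable valuation. If $t \to^\infty t_n \in [\![\nu]\!]_{v}^{n}$ for every $n \in \mathbb{N}$, then there exists $t_\infty \in [\![\nu]\!]_{v}^{\infty}$ such that $t \to^\infty t_\infty$.
   Context: Terms: $\mathbb{T}^\infty$ is the set of finite and infinite terms $t ::= x \mid c \mid \lambda x.t \mid t\,t \mid \mathrm{case}(t;\{c_k\vec{x}\Rightarrow t_k \mid k=1,\dots,n\})$ (variables $x$, constructors $c$), modulo $\alpha$-conversion, with reductions $(\lambda x.t)t' \to_\beta t[t'/x]$ and $\mathrm{case}(c_k\vec{u};\{c_l\vec{x}\Rightarrow t_l\}) \to_\iota t_k[\vec{u}/\vec{x}]$; $\to^*$ is finitary $\beta\iota$-reduction. Infinitary reduction $t \to^\infty t'$ is defined coinductively: $t\to^\infty x$ if $t\to^* x$; $t\to^\infty c$ if $t\to^* c$; $t\to^\infty \lambda x.r'$ if $t\to^*\lambda x.r$ and $r\to^\infty r'$; $t\to^\infty r_1'r_2'$ if $t\to^* r_1r_2$ and $r_k\to^\infty r_k'$; $t\to^\infty \mathrm{case}(r';\{c_k\vec{x}\Rightarrow r_k'\})$ if $t\to^*\mathrm{case}(r;\{c_k\vec{x}\Rightarrow r_k\})$, $r\to^\infty r'$ and $r_k\to^\infty r_k'$. Types: size expressions $s ::= \infty \mid 0 \mid i \mid s+1 \mid \min(s,s)\mid\max(s,s)$ ($i$ a size variable); types $\tau ::= A \mid d^s(\tau_1,\dots,\tau_n) \mid \tau_1\to\tau_2 \mid \forall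 i.\tau$ ($A$ a type variable, $d$ a (co)inductive definition name; $d(\vec\tau)$ abbreviates $d^\infty(\vec\tau)$). A type is strictly positive if it is closed, a type variable, $\tau_1\to\tau_2$ with $\tau_1$ closed and $\tau_2$ strictly positive, $\forall i.\tau'$ with $\tau'$ strictly positive, or $d^\infty(\vec\alpha)$ with each $\alpha_k$ strictly positive. A coinductive (resp. inductive) definition is $d(B_1,\dots,B_n)=\mathrm{CoInd}(A)\{c_k:\vec{\sigma_k}\mid k=1,\dots,m\}$ (resp. $\mathrm{Ind}$), where $A$ is the recursive type variable, $B_j$ the parameter type variables, each constructor argument type $\sigma_k^l$ is strictly positive, has type variables among $A,\vec B$ and no free size variables, and a well-founded order on definitions ensures each definition occurring in a constructor argument type of $d$ is smaller than $d$. Here $\nu=d_\nu(\alpha_1,\dots,\alpha_n)$ with $d_\nu$ a coinductive definition and the $\alpha_j$ closed strictly positive types. Semantics: $\infty$ denotes an ordinal large enough that every monotone function on the powerset of $\mathbb{T}^\infty$ reaches its least and greatest fixpoints within $\infty$ iterations; $\Omega$ is the set of ordinals $\le\infty$; a size variable valuation is $v:\mathcal{V}_S\to\Omega$, extended to size expressions ($v(s+1)=\min(v(s)+1,\infty)$, etc.); $\xi$ maps type variables to subsets of $\mathbb{T}^\infty$. For a definition $d$, $\Phi_{d,\xi,v}(X)$ is the set of terms $c_k t^1\dots t^{n_k}$ with $t^l\in[\![\sigma_k^l]\!]_{\xi[X/A],v}$. For coinductive $d$: $[\![d]\!]^0_{\xi,v}=\mathbb{T}^\infty$, $[\![d]\!]^{\kappa+1}_{\xi,v}=\Phi_{d,\xi,v}([\![d]\!]^{\kappa}_{\xi,v})$,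 and intersection over smaller ordinals at limits; for inductive $d$: start from $\emptyset$, same successor step, union at limits. For $\rho=d(\vec\alpha)$, $[\![\rho]\!]^\kappa_{\xi,v}=[\![d]\!]^\kappa_{\xi[\vec Y/\vec B],v}$ with $Y_j=[\![\alpha_j]\!]_{\xi,v}$; $[\![\rho^s]\!]_{\xi,v}=[\![\rho]\!]^{v(s)}_{\xi,v}$; $[\![A]\!]_{\xi,v}=\xi(A)$; $t\in[\![\forall i.\tau]\!]_{\xi,v}$ iff $i$ is not free in $t$ and for every $\kappa\in\Omega$ there is $t'$ with $t\to^\infty t'\in[\![\tau]\!]_{\xi,v[\kappa/i]}$; $t\in[\![\alpha\to\beta]\!]_{\xi,v}$ iff for every $r\in[\![\alpha]\!]_{\xi,v}$ there is $t'$ with $t\,r\to^\infty t'\in[\![\beta]\!]_{\xi,v}$. For closed types $\xi$ is omitted, so $[\![\nu]\!]_v^{\kappa}$ is the $\kappa$-th approximation of $\nu$ and $[\![\nu]\!]_v^{\infty}$ (the greatest fixpoint) is the interpretation of $\nu$. *)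

(* Defs.v *)
From Stdlib Require Import Relations Wellfounded.
From HB Require Import structures.
From mathcomp Require Import all_boot all_order finmap.
From mathcomp Require Import boolp classical_sets.

Set Implicit Arguments.
Unset Strict Implicit.
Unset Printing Implicit Defensive.

Import Order.TTheory.
Local Open Scope classical_set_scope.
Local Open Scope order_scope.

(** Terms modulo alpha-conversion are represented with de Bruijn indices.
    In [Case t ar bs] the finite map [ar] sends each constructor [c_k] that has
    a branch to the number of variables its pattern [c_k x_1 .. x_n] binds
    (so the constructors of the branches are pairwise distinct), and the branch
    [bs [` _]] lives under these [n] binders, index [l < n] being [x_(l+1)].
    Infinite terms that differ only as Rocq values (bisimilar but not provably
    equal) are never told apart below: reduction and all the interpretations of
    closed types only look at terms by case analysis, at any finite depth. *)
CoInductive term (C : choiceType) : Type :=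
| Var (x : nat)
| Con (c : C)
| Lam (t : term C)
| App (t u : term C)
| Case (t : term C) (ar : {fmap C -> nat}) (bs : domf ar -> term C).

Arguments Var {C} x.
Arguments Con {C} c.

Definition apps (C : choiceType) (t : term C) (us : seq (term C)) : term C :=
  foldl (@App C) t us.

Definition uprn (n : nat) (f : nat -> nat) (x : nat) : nat :=
  if (x < n)%N then x else (n + f (x - n))%N.

CoFixpoint rename (C : choiceType) (f : nat -> nat) (t : term C) : term C :=
  match t with
  | Var x => Var (f x)
  | Con c => Con c
  | Lam t1 => Lam (rename (uprn 1 f) t1)
  | App t1 t2 => App (rename f t1) (rename f t2)
  | Case t1 ar bs =>
      Case (rename f t1) (fun k => rename (uprn (ar k) f) (bs k))
  end.

Definition upn (C : choiceType) (n : nat) (s : nat -> term C) (x : nat)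
    : term C :=
  if (x < n)%N then Var x else rename (addn n) (s (x - n)%N).

CoFixpoint subst (C : choiceType) (s : nat -> term C) (t : term C) : term C :=
  match t with
  | Var x => s x
  | Con c => Con c
  | Lam t1 => Lam (subst (upn 1 s) t1)
  | App t1 t2 => App (subst s t1) (subst s t2)
  | Case t1 ar bs =>
      Case (subst s t1) (fun k => subst (upn (ar k) s) (bs k))
  end.

(** [t[us/xs]]: the outermost [size us] indices are replaced by [us] and the
    other ones are lowered. *)
Definition inst (C : choiceType) (us : seq (term C)) (t : term C) : term C :=
  subst (fun x => nth (Var (x - size us)%N) us x) t.

Inductive step (C : choiceType) : term C -> term C -> Prop :=
| step_beta t u : step (App (Lam t) u) (inst [:: u] t)
| step_iota (ar : {fmap C -> nat}) (bs : domf ar -> term C)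
    (k : domf ar) (us : seq (term C)) :
    size us = ar k ->
    step (Case (apps (Con (val k)) us) bs) (inst us (bs k))
| step_lam t t' : step t t' -> step (Lam t) (Lam t')
| step_appl t t' u : step t t' -> step (App t u) (App t' u)
| step_appr t u u' : step u u' -> step (App t u) (App t u')
| step_case t t' (ar : {fmap C -> nat}) (bs : domf ar -> term C) :
    step t t' -> step (Case t bs) (Case t' bs)
| step_branch t (ar : {fmap C -> nat}) (bs bs' : domf ar -> term C)
    (k : domf ar) :
    step (bs k) (bs' k) -> (forall j, j != k -> bs' j = bs j) ->
    step (Case t bs) (Case t bs').

Definition steps (C : choiceType) : term C -> term C -> Prop :=
  clos_refl_trans (term C) (@step C).

CoInductive infred (C : choiceType) (t : term C) : term C -> Prop :=
| infred_var x : steps t (Var x) -> infred t (Var x)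
| infred_con c : steps t (Con c) -> infred t (Con c)
| infred_lam r r' : steps t (Lam r) -> infred r r' -> infred t (Lam r')
| infred_app r1 r2 r1' r2' :
    steps t (App r1 r2) -> infred r1 r1' -> infred r2 r2' ->
    infred t (App r1' r2')
| infred_case r r' (ar : {fmap C -> nat}) (bs bs' : domf ar -> term C) :
    steps t (Case r bs) -> infred r r' ->
    (forall k, infred (bs k) (bs' k)) ->
    infred t (Case r' bs').

Section Iteration.
Context {disp : Order.disp_t} {Om : tbOrderType disp}.

(** The successor, capped at the greatest element: [min(x + 1, \top)]. *)
Definition osucc (x : Om) : Om :=
  xget \top [set y | x < y /\ forall z, x < z -> y <= z].

Definition onat (n : nat) : Om := iter n osucc \bot.

Definition is_limit (k : Om) : Prop :=
  \bot < k /\ forall l, l < k -> osucc l < k.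

Context (wf : well_founded (fun x y : Om => x < y)).

Context {T : Type} (F : set T -> set T).

(** The iterates of [F] from [set0] upwards (unions at limits), and from [setT]
    downwards (intersections at limits); see the equations below. *)
Definition iter_up : Om -> set T :=
  Fix wf (fun _ => set T) (fun k rec => [set t |
    (exists l (h : l < k), k = osucc l /\ F (rec l h) t) \/
    (is_limit k /\ exists l (h : l < k), rec l h t)]).

Definition iter_down : Om -> set T :=
  Fix wf (fun _ => set T) (fun k rec => [set t |
    (forall l (h : l < k), k = osucc l -> F (rec l h) t) /\
    (is_limit k -> forall l (h : l < k), rec l h t)]).

End Iteration.

Definition monotone (T : Type) (F : set T -> set T) : Prop :=
  forall X Y, X `<=` Y -> F X `<=` F Y.

Definition is_lfp (T : Type) (F : set T -> set T) (X : set T) : Prop :=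
  F X = X /\ forall Y, F Y = Y -> X `<=` Y.

Definition is_gfp (T : Type) (F : set T -> set T) (X : set T) : Prop :=
  F X = X /\ forall Y, F Y = Y -> Y `<=` X.

(** The set of ordinals not greater than some ordinal [\top] (written infinity
    in size expressions) that is large enough for the powerset of [T]: up to
    isomorphism, a well-order with a greatest element. *)
Record sizeOrdinals (T : Type) (disp : Order.disp_t) := SizeOrdinals {
  ords :> tbOrderType disp;
  ords_wf : well_founded (fun x y : ords => x < y);
  ords_large : forall F : set T -> set T, monotone F ->
    is_lfp F (iter_up ords_wf F \top) /\ is_gfp F (iter_down ords_wf F \top)
}.

Inductive size_exp : Type :=
| SInf
| SZero
| SVar (i : nat)
| SSucc (s : size_exp)
| SMin (s1 s2 : size_exp)
| SMax (s1 s2 : size_exp).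

Fixpoint size_val disp (Om : tbOrderType disp) (v : nat -> Om) (s : size_exp)
    : Om :=
  match s with
  | SInf => \top
  | SZero => \bot
  | SVar i => v i
  | SSucc s1 => osucc (size_val v s1)
  | SMin s1 s2 => Order.min (size_val v s1) (size_val v s2)
  | SMax s1 s2 => Order.max (size_val v s1) (size_val v s2)
  end.

Fixpoint svar_in (i : nat) (s : size_exp) : Prop :=
  match s with
  | SInf | SZero => False
  | SVar j => i = j
  | SSucc s1 => svar_in i s1
  | SMin s1 s2 | SMax s1 s2 => svar_in i s1 \/ svar_in i s2
  end.

(** The names of the (co)inductive definitions, with the number of their
    parameters. *)
Record def_names := DefNames {
  dname :> Type;
  arity : dname -> nat
}.

(** Type and size variables are natural numbers; [TAll i tau] binds the size
    variable [i] by name. *)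
Inductive ty (N : def_names) : Type :=
| TVar (A : nat)
| TData (d : N) (s : size_exp) (args : 'I_(arity d) -> ty N)
| TArr (t1 t2 : ty N)
| TAll (i : nat) (t : ty N).

Arguments TVar {N} A.

Fixpoint tvar_in (N : def_names) (A : nat) (tau : ty N) : Prop :=
  match tau with
  | TVar B => A = B
  | TData d s args => exists j, tvar_in A (args j)
  | TArr t1 t2 => tvar_in A t1 \/ tvar_in A t2
  | TAll i t => tvar_in A t
  end.

Fixpoint free_svar_in (N : def_names) (i : nat) (tau : ty N) : Prop :=
  match tau with
  | TVar B => False
  | TData d s args => svar_in i s \/ exists j, free_svar_in i (args j)
  | TArr t1 t2 => free_svar_in i t1 \/ free_svar_in i t2
  | TAll j t => i <> j /\ free_svar_in i t
  end.

Fixpoint def_in (N : def_names) (d : N) (tau : ty N) : Prop :=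
  match tau with
  | TVar B => False
  | TData d' s args => d = d' \/ exists j, def_in d (args j)
  | TArr t1 t2 => def_in d t1 \/ def_in d t2
  | TAll j t => def_in d t
  end.

(** Free size variables are allowed in closed types. *)
Definition ty_closed (N : def_names) (tau : ty N) : Prop :=
  forall A, ~ tvar_in A tau.

Inductive strictly_positive (N : def_names) : ty N -> Prop :=
| sp_closed tau : ty_closed tau -> strictly_positive tau
| sp_var A : strictly_positive (TVar A)
| sp_arr t1 t2 :
    ty_closed t1 -> strictly_positive t2 -> strictly_positive (TArr t1 t2)
| sp_all i t : strictly_positive t -> strictly_positive (TAll i t)
| sp_data (d : N) (args : 'I_(arity d) -> ty N) :
    (forall j, strictly_positive (args j)) ->
    strictly_positive (TData SInf args).

Inductive def_kind := Ind | CoInd.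

(** [d(B_1,..,B_n) = (Co)Ind(A){c_k : sigma_k^1 .. sigma_k^(n_k) | k < m}] with
    [A = rec_var] and [B_(j+1) = tnth params j]. *)
Record definition (C : choiceType) (N : def_names) (n : nat) := MkDefinition {
  kind : def_kind;
  rec_var : nat;
  params : n.-tuple nat;
  vars_uniq : uniq (rec_var :: params);
  nctors : nat;
  ctor : 'I_nctors -> C;
  ctor_inj : injective ctor;
  nargs : 'I_nctors -> nat;
  ctor_arg : forall k : 'I_nctors, 'I_(nargs k) -> ty N
}.

Record def_system (C : choiceType) := DefSystem {
  names :> def_names;
  def : forall d : names, definition C names (arity d);
  def_lt : names -> names -> Prop;
  def_lt_trans : forall d1 d2 d3,
    def_lt d1 d2 -> def_lt d2 d3 -> def_lt d1 d3;
  def_lt_wf : well_founded def_lt;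
  ctor_arg_sp : forall d k l, strictly_positive (@ctor_arg _ _ _ (def d) k l);
  ctor_arg_tvars : forall d k l A, tvar_in A (@ctor_arg _ _ _ (def d) k l) ->
    A \in rec_var (def d) :: params (def d);
  ctor_arg_svars : forall d k l i,
    ~ free_svar_in i (@ctor_arg _ _ _ (def d) k l);
  ctor_arg_defs : forall d k l d', def_in d' (@ctor_arg _ _ _ (def d) k l) ->
    def_lt d' d
}.

Definition upd (T : Type) (f : nat -> T) (i : nat) (x : T) : nat -> T :=
  fun j => if j == i then x else f j.

Definition upds (T : Type) (f : nat -> T) (n : nat) (Bs : n.-tuple nat)
    (Y : 'I_n -> T) : nat -> T :=
  fun A => if [pick j | tnth Bs j == A] is Some j then Y j else f A.

Definition tenv (C : choiceType) := nat -> set (term C).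
Definition senv (T : Type) (disp : Order.disp_t) (Om : sizeOrdinals T disp) :=
  nat -> Om.

Section Interpretation.
Context {C : choiceType} (D : def_system C) {disp : Order.disp_t}
  (Om : sizeOrdinals (term C) disp).

(** The interpretation of types, given the approximations [I d k xi v] of the
    definitions [d]. No size variable ever occurs in a term, hence the proviso
    that [i] is not free in [t] is void in the clause of [TAll i _]. *)
Fixpoint ty_sem_of (I : D -> Om -> tenv C -> senv Om -> set (term C))
    (tau : ty D) (xi : tenv C) (v : senv Om) {struct tau} : set (term C) :=
  match tau with
  | TVar A => xi A
  | TData d s args =>
      I d (size_val v s)
        (upds xi (params (def d)) (fun j => ty_sem_of I (args j) xi v)) v
  | TArr t1 t2 => [set t | forall r, ty_sem_of I t1 xi v r ->
      exists t', infred (App t r) t' /\ ty_sem_of I t2 xi v t']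
  | TAll i t1 => [set t | forall k : Om,
      exists t', infred t t' /\ ty_sem_of I t1 xi (upd v i k) t']
  end.

Definition Phi_of (I : D -> Om -> tenv C -> senv Om -> set (term C)) (d : D)
    (xi : tenv C) (v : senv Om) (X : set (term C)) : set (term C) :=
  [set t | exists (k : 'I_(nctors (def d))) (us : (nargs k).-tuple (term C)),
     t = apps (Con (ctor k)) us /\
     forall l, ty_sem_of I (ctor_arg l) (upd xi (rec_var (def d)) X) v
                 (tnth us l)].

Definition iter_def (d : D) (F : set (term C) -> set (term C))
    : Om -> set (term C) :=
  match kind (def d) with
  | Ind => iter_up (@ords_wf _ _ Om) F
  | CoInd => iter_down (@ords_wf _ _ Om) F
  end.

(** The approximations of definitions, by recursion on the order of
    definitions; [def_semE] below is the intended equation. *)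
Definition def_sem : D -> Om -> tenv C -> senv Om -> set (term C) :=
  Fix (@def_lt_wf _ D) (fun _ => Om -> tenv C -> senv Om -> set (term C))
    (fun d rec k xi v =>
       iter_def d
         (Phi_of (fun d' k' xi' v' => [set t |
                    exists h : def_lt d' d, rec d' h k' xi' v' t]) d xi v) k).

Definition ty_sem : ty D -> tenv C -> senv Om -> set (term C) := ty_sem_of def_sem.

Definition Phi : D -> tenv C -> senv Om -> set (term C) -> set (term C) :=
  Phi_of def_sem.

(** The [k]-th approximation of the type [d(args)]. *)
Definition data_sem (d : D) (args : 'I_(arity d) -> ty D) (k : Om)
    (xi : tenv C) (v : senv Om) : set (term C) :=
  def_sem d k (upds xi (params (def d)) (fun j => ty_sem (args j) xi v)) v.

End Interpretation.

Section IterationTheory.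
Context {disp : Order.disp_t} {Om : tbOrderType disp}.
Context (wf : well_founded (fun x y : Om => x < y)).

Lemma wf_least (P : set Om) : P !=set0 ->
  exists2 x, P x & forall y, P y -> x <= y.
Proof.
case=> x; elim/(well_founded_ind wf): x => x IH Px.
have [[y [Py yx]]|H] := pselect (exists y, P y /\ y < x); first exact: IH Py.
exists x => // y Py; rewrite leNgt; apply/negP => yx; apply: H.
by exists y.
Qed.

Lemma osuccP (x : Om) : x < \top ->
  x < osucc x /\ forall z, x < z -> osucc x <= z.
Proof.
move=> xT; apply: (@xgetPex _ \top [set y | x < y /\ forall z, x < z -> y <= z]).
have [y xy yl] := @wf_least [set y | x < y] (ex_intro _ \top xT).
by exists y.
Qed.

Lemma osucc_top : osucc \top = \top :> Om.
Proof. by apply: xgetPN => y [/=]; rewrite ltNge lex1. Qed.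

Lemma osucc_inj (x y : Om) :
  x < \top -> y < \top -> osucc x = osucc y -> x = y.
Proof.
move=> /osuccP[xs xl] /osuccP[ys yl] e; apply/eqP; rewrite eq_le !leNgt.
by apply/andP; split; apply/negP => h; [move: (yl _ h)|move: (xl _ h)];
  rewrite ?e -?e leNgt ?xs ?ys // e ys.
Qed.

Lemma is_limitNsucc (x : Om) : x < \top -> ~ is_limit (osucc x).
Proof. by move=> xT [_ /(_ _ (osuccP xT).1)]; rewrite ltxx. Qed.

Context {T : Type} (F : set T -> set T).

Lemma iter_upE k : iter_up wf F k = [set t |
    (exists l (h : l < k), k = osucc l /\ F (iter_up wf F l) t) \/
    (is_limit k /\ exists l (h : l < k), iter_up wf F l t)].
Proof.
rewrite {1}/iter_up Fix_eq // => x f g e.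
suff -> : f = g by [].
by apply: functional_extensionality_dep => l;
   apply: functional_extensionality_dep => h.
Qed.

Lemma iter_downE k : iter_down wf F k = [set t |
    (forall l (h : l < k), k = osucc l -> F (iter_down wf F l) t) /\
    (is_limit k -> forall l (h : l < k), iter_down wf F l t)].
Proof.
rewrite {1}/iter_down Fix_eq // => x f g e.
suff -> : f = g by [].
by apply: functional_extensionality_dep => l;
   apply: functional_extensionality_dep => h.
Qed.

Lemma iter_up0 : iter_up wf F \bot = set0.
Proof.
rewrite iter_upE; apply/seteqP; split=> // t /= [[l [h _]]|[_ [l [h _]]]];
by move: h; rewrite ltx0.
Qed.

Lemma iter_down0 : iter_down wf F \bot = setT.
Proof.
rewrite iter_downE; apply/seteqP; split=> // t _ /=; split=> [l h|_ l h];
by move: h; rewrite ltx0.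
Qed.

Lemma iter_upS k : k < \top -> iter_up wf F (osucc k) = F (iter_up wf F k).
Proof.
move=> kT; rewrite iter_upE; apply/seteqP; split=> t /=.
  case=> [[l [h [e Ft]]]|[/(is_limitNsucc kT)//]].
  suff -> : k = l by [].
  by apply: osucc_inj e => //; apply: lt_le_trans h (lex1 _).
by move=> Ft; left; exists k, (osuccP kT).1.
Qed.

Lemma iter_downS k :
  k < \top -> iter_down wf F (osucc k) = F (iter_down wf F k).
Proof.
move=> kT; rewrite iter_downE; apply/seteqP; split=> t /=.
  by case=> /(_ k (osuccP kT).1 erefl).
move=> Ft; split=> [l h e|/(is_limitNsucc kT)//].
suff <- : k = l by [].
by apply: osucc_inj e => //; apply: lt_le_trans h (lex1 _).
Qed.

Lemma iter_up_lim k : is_limit k ->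
  iter_up wf F k = \bigcup_(l in [set l | l < k]) iter_up wf F l.
Proof.
move=> kl; rewrite iter_upE; apply/seteqP; split=> t /=.
  case=> [[l [h [e _]]]|[_ [l [h Ft]]]]; last by exists l.
  by case: kl => _ /(_ _ h); rewrite -e ltxx.
by case=> l /= h Ft; right; split=> //; exists l, h.
Qed.

Lemma iter_down_lim k : is_limit k ->
  iter_down wf F k = \bigcap_(l in [set l | l < k]) iter_down wf F l.
Proof.
move=> kl; rewrite iter_downE; apply/seteqP; split=> t /=.
  by move=> [_ /(_ kl) H] l /= h; apply: H.
move=> H; split=> [l h e|_ l h]; last exact: H.
by case: kl => _ /(_ _ h); rewrite -e ltxx.
Qed.

End IterationTheory.

Section InterpretationTheory.
Context {C : choiceType} (D : def_system C) {disp : Order.disp_t}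
  (Om : sizeOrdinals (term C) disp).

Lemma eq_ty_sem_of (I J : D -> Om -> tenv C -> senv Om -> set (term C)) tau :
  (forall d, def_in d tau -> I d = J d) -> ty_sem_of I tau = ty_sem_of J tau.
Proof.
elim: tau => [A|d s args IH|t1 IH1 t2 IH2|i t IH] //= H;
  apply: funext => xi; apply: funext => v.
- rewrite H; last by left.
  congr (J d _ (upds _ _ _) _); apply: funext => j.
  by rewrite IH // => d' d'in; apply: H; right; exists j.
- rewrite IH1; last by move=> *; apply: H; left.
  by rewrite IH2 // => *; apply: H; right.
- by rewrite IH.
Qed.

Lemma def_semE (d : D) (k : Om) (xi : tenv C) (v : senv Om) :
  def_sem d k xi v = iter_def d (Phi d xi v) k.
Proof.
rewrite {1}/def_sem Fix_eq; last first.
  move=> x f g e; suff -> : f = g by [].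
  by apply: functional_extensionality_dep => l;
     apply: functional_extensionality_dep => h.
congr iter_def; apply: funext => X; apply/seteqP; rewrite /Phi /Phi_of.
have E (k0 : 'I_(nctors (def d))) (l : 'I_(nargs k0)) :
    ty_sem_of (fun d' k' xi' v' => [set t |
      exists h : def_lt d' d, @def_sem _ _ _ Om d' k' xi' v' t]) (ctor_arg l)
    = ty_sem_of (@def_sem _ _ _ Om) (ctor_arg l).
  apply: eq_ty_sem_of => d' /ctor_arg_defs d'd.
  do 3 apply: funext => ?; apply/seteqP; split=> t /= => [[]//|Ht].
  by exists d'd.
by split=> t /= [k0 [us [-> H]]]; exists k0, us; split=> // l;
  have := H l; rewrite E.
Qed.

Lemma ty_sem_data (d : D) (s : size_exp) (args : 'I_(arity d) -> ty D)
    (xi : tenv C) (v : senv Om) :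
  ty_sem (TData s args) xi v = data_sem args (size_val v s) xi v.
Proof. by []. Qed.

End InterpretationTheory.

(* Main.v *)
Require Import Defs.
From mathcomp Require Import all_boot all_order.
From Stdlib Require Import Relations Wellfounded.
From mathcomp Require Import finmap boolp classical_sets.

(** Weak head reduction is deterministic, so every term [w] has a canonical
    reduct [nf w]: as long as [w] weakly head reduces to a constructor
    application, replace it by this application and go on in the arguments.
    By standardization, if [w] infinitarily reduces to a constructor
    application then [nf w] has the same head and its arguments are normal
    forms of terms that reduce to the arguments. Hence every interpretation
    [X] is [nf_closed]: if [w] reduces to an element of [X], then [nf w] is in
    [X]. So one single term, [nf t], lies in all the finite approximations.
    Interpretations of strictly positive types commute with countable
    intersections of [nf_closed] sets (here [nf (App t r)] provides the uniform
    witness for function types), so the intersection of the finite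
    approximations is a post-fixpoint, below the greatest fixpoint. *)

Set Implicit Arguments.
Unset Strict Implicit.
Unset Printing Implicit Defensive.

Import Order.TTheory.
Local Open Scope classical_set_scope.

(** * Coinductive reductions, one layer at a time *)

Section Coinduction.
Context {C : choiceType}.
Implicit Types (R S : term C -> term C -> Prop) (t u : term C).

(** A cofixpoint computes only under a match, so rewriting with this identity forces one unfolding
    of a corecursive term. *)
Lemma termE t : t = match t with
  | Var x => Var x | Con c => Con c | Lam t1 => Lam t1
  | App t1 t2 => App t1 t2 | Case t1 ar bs => Case t1 bs end.
Proof. by case: t. Qed.

Lemma rename_var f x : rename f (Var x) = Var (f x) :> term C.
Proof. exact: termE. Qed.
Lemma rename_con f c : rename f (Con c) = Con c :> term C.
Proof. exact: termE. Qed.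
Lemma rename_lam f t : rename f (Lam t) = Lam (rename (uprn 1 f) t).
Proof. exact: termE. Qed.
Lemma rename_app f t u : rename f (App t u) = App (rename f t) (rename f u).
Proof. exact: termE. Qed.
Lemma rename_case f t (ar : {fmap C -> nat}) (bs : domf ar -> term C) :
  rename f (Case t bs) =
  Case (rename f t) (fun k => rename (uprn (ar k) f) (bs k)).
Proof. exact: termE. Qed.
Definition renameE :=
  (rename_var, rename_con, rename_lam, rename_app, rename_case).

Lemma subst_var s x : subst s (Var x) = s x :> term C.
Proof. by rewrite [LHS]termE /=; case: (s x). Qed.
Lemma subst_con s c : subst s (Con c) = Con c :> term C.
Proof. exact: termE. Qed.
Lemma subst_lam s t : subst s (Lam t) = Lam (subst (upn 1 s) t).
Proof. exact: termE. Qed.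
Lemma subst_app s t u : subst s (App t u) = App (subst s t) (subst s u).
Proof. exact: termE. Qed.
Lemma subst_case s t (ar : {fmap C -> nat}) (bs : domf ar -> term C) :
  subst s (Case t bs) = Case (subst s t) (fun k => subst (upn (ar k) s) (bs k)).
Proof. exact: termE. Qed.
Definition substE := (subst_var, subst_con, subst_lam, subst_app, subst_case).

(** One layer of a coinductive reduction that uses [S] at the root: [infred],
    its standard form [sred] and bisimilarity are the greatest fixpoints for
    [S] the relations [steps], [whs] and equality. *)
Definition layer S R t t' : Prop :=
  match t' with
  | Var x => S t (Var x)
  | Con c => S t (Con c)
  | Lam r' => exists2 r, S t (Lam r) & R r r'
  | App a' b' => exists a b, [/\ S t (App a b), R a a' & R b b']
  | Case r' ar bs' => exists r (bs : domf ar -> term C),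
      [/\ S t (Case r bs), R r r' & forall k, R (bs k) (bs' k)]
  end.

(** The greatest fixpoint is encoded as the union of all post-fixpoints: a coinductive proof then
    exhibits a relation and escapes the guardedness condition. *)
Definition nured S t t' : Prop :=
  exists2 R, forall a b, R a b -> layer S R a b & R t t'.

Lemma layer_mono S1 S2 R1 R2 t1 t2 t' :
  (forall a, S1 t1 a -> S2 t2 a) -> (forall a b, R1 a b -> R2 a b) ->
  layer S1 R1 t1 t' -> layer S2 R2 t2 t'.
Proof.
move=> S12 R12; case: t' => [x|c|r'|a' b'|r' ar bs'] /=; try exact: S12.
- by case=> r /S12 ? /R12 ?; exists r.
- by case=> a [b [/S12 ? /R12 ? /R12 ?]]; exists a, b.
- case=> r [bs [/S12 ? /R12 ? h]]; exists r, bs; split=> // k; exact: R12.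
Qed.

Lemma nured_unfold S t t' : nured S t t' -> layer S (nured S) t t'.
Proof.
by case=> R post /post; apply: layer_mono => // a b Rab; exists R.
Qed.

(** The union of [R] and [nured S] is a post-fixpoint, so subterms may be handed over to a reduction
    that is already known. *)
Lemma nured_coind S R :
  (forall a b, R a b -> layer S (fun a b => R a b \/ nured S a b) a b) ->
  forall t t', R t t' -> nured S t t'.
Proof.
move=> post t t' Rtt'; exists (fun a b => R a b \/ nured S a b); last by left.
move=> a b [/post //|/nured_unfold]; apply: layer_mono => // ? ? ?; by right.
Qed.

Lemma nured_fold S t t' : layer S (nured S) t t' -> nured S t t'.
Proof.
move=> h; apply: (@nured_coind S (layer S (nured S))) h => a b.
by apply: layer_mono => // ? ? ?; right.
Qed.

Lemma nured_refl S : (forall t, S t t) -> forall t, nured S t t.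
Proof.
move=> Sr t; apply: (@nured_coind S eq) => // a _ <-.
case: a => [x|c|r|a b|r ar bs] //=.
- by exists r => //; left.
- by exists a, b; split=> //; left.
- by exists r, bs; split=> // *; left.
Qed.

Lemma nured_trans_l S t u u' : (forall a b c, S a b -> S b c -> S a c) ->
  S t u -> nured S u u' -> nured S t u'.
Proof.
move=> St Stu /nured_unfold h; apply: nured_fold.
by apply: layer_mono h => // a; apply: St.
Qed.

Lemma infred_layer t t' : infred t t' -> layer (@steps C) (@infred C) t t'.
Proof.
case=> {t'} /=; try by [].
- by move=> r r'; exists r.
- by move=> a b a' b'; exists a, b.
- by move=> r r' ar bs bs' st rr' bb'; exists r, bs.
Qed.

(** Bridge to the native coinductive predicate: each case of [layer] matches one constructor of
    [infred], which guards the corecursive calls. *)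
Lemma infred_coind R :
  (forall a b, R a b -> layer (@steps C) R a b) ->
  forall t t', R t t' -> infred t t'.
Proof.
move=> post; cofix IH => t t' /post.
case: t' => [x|c|r'|a' b'|r' ar bs'] /=.
- exact: infred_var.
- exact: infred_con.
- by case=> r st /IH; apply: infred_lam.
- by case=> a [b [st /IH ha /IH hb]]; apply: infred_app st ha hb.
- case=> r [bs [st /IH hr h]]; apply: infred_case st hr _ => k.
  exact: IH (h k).
Qed.

End Coinduction.

(** * Bisimilarity and the substitution calculus *)

Section Bisimilarity.
Context {C : choiceType}.
Implicit Types (t u a b : term C) (s : nat -> term C) (f g : nat -> nat).

(** The laws of substitution relate corecursive terms that need not be provably equal as Rocq
    values; they are established up to this relation instead. *)
Definition bisim : term C -> term C -> Prop := nured eq.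

Lemma bisim_refl t : bisim t t.
Proof. exact: nured_refl. Qed.
#[local] Hint Resolve bisim_refl : core.

Lemma bisim_sym t u : bisim t u -> bisim u t.
Proof.
apply: (@nured_coind _ _ (fun a b => bisim b a)) => {t u} a b /nured_unfold.
case: a => [x|c|r'|a' b'|r' ar bs'] /=.
- by move->.
- by move->.
- by case=> r -> h; exists r' => //; left.
- by case=> a [d [-> h h']]; exists a', b'; split; [|left|left].
- case=> r [bs [-> h h']] /=; exists r', bs'; split; [by []|by left|].
  by move=> k; left; apply: h'.
Qed.

Lemma bisim_trans u t t' : bisim t u -> bisim u t' -> bisim t t'.
Proof.
move=> h h'.
apply: (@nured_coind _ _ (fun a b => exists2 c, bisim a c & bisim c b));
  last by exists u.
move=> {h h'} {u t t'} a b [c /[swap] /nured_unfold].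
case: b => [x|c'|r'|a' b'|r' ar bs'] /=.
- by move-> => /nured_unfold.
- by move-> => /nured_unfold.
- case=> r -> h /nured_unfold[r0 -> h0].
  by exists r0 => //; left; exists r.
- case=> d [e [-> h h']] /nured_unfold[d0 [e0 [-> h0 h0']]]; exists d0, e0.
  by split=> //; left; [exists d|exists e].
- case=> r [bs [-> h h']] /nured_unfold[r0 [bs0 [-> h0 h0']]].
  exists r0, bs0.
  split; [by []|by left; exists r|move=> k; left].
  by exists (bs k); [apply: h0'|apply: h'].
Qed.

Lemma bisim_var x t : bisim (Var x) t -> t = Var x.
Proof. by move/bisim_sym/nured_unfold. Qed.

Lemma bisim_con c t : bisim (Con c) t -> t = Con c.
Proof. by move/bisim_sym/nured_unfold. Qed.

Lemma bisim_lam r t : bisim (Lam r) t -> exists2 r', t = Lam r' & bisim r r'.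
Proof.
by move/bisim_sym/nured_unfold => -[r' -> h]; exists r' => //; apply: bisim_sym.
Qed.

Lemma bisim_app a b t : bisim (App a b) t ->
  exists a' b', [/\ t = App a' b', bisim a a' & bisim b b'].
Proof.
move/bisim_sym/nured_unfold => -[a' [b' [-> h h']]]; exists a', b'.
by split=> //; apply: bisim_sym.
Qed.

Lemma bisim_case r (ar : {fmap C -> nat}) (bs : domf ar -> term C) t :
  bisim (Case r bs) t -> exists r' (bs' : domf ar -> term C),
  [/\ t = Case r' bs', bisim r r' & forall k, bisim (bs k) (bs' k)].
Proof.
move/bisim_sym/nured_unfold => -[r' [bs' [-> h h']]]; exists r', bs'.
split; [by []|exact: bisim_sym|move=> k].
exact/bisim_sym/h'.
Qed.

(** Here and in the laws below, the functions are quantified inside the coinduction relation and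
    related pointwise, so that the hypothesis can be lifted under binders. *)
Lemma bisim_rename t u f g : bisim t u -> f =1 g ->
  bisim (rename f t) (rename g u).
Proof.
move=> tu fg; apply: (@nured_coind _ _ (fun a b => exists t u f g,
  [/\ a = rename f t, b = rename g u, bisim t u & f =1 g])); last first.
  by exists t, u, f, g.
move=> {tu fg} {t u f g} _ _ [t [u [f [g [-> -> tu fg]]]]].
have upE n : uprn n f =1 uprn n g by move=> x; rewrite /uprn fg.
case: t tu => [x /bisim_var|c /bisim_con|r /bisim_lam|a b /bisim_app|
  r ar bs /bisim_case].
- by move->; rewrite !renameE fg.
- by move->; rewrite !renameE.
- case=> r' -> h; rewrite !renameE /=; eexists; [by []|left]; by eexists _, _, _, _.
- case=> a' [b' [-> h h']]; rewrite !renameE /=; eexists _, _.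
  by split; [by []|left|left]; eexists _, _, f, g.
- case=> r' [bs' [-> h h']]; rewrite !renameE /=; eexists _, _.
  split; [by []|left|move=> k; left]; first by eexists _, _, f, g.
  by eexists _, _, _, _; split; [by []|by []|apply: h'|].
Qed.

Lemma rename_subst f s t : (forall x, bisim (Var (f x)) (s x)) ->
  bisim (rename f t) (subst s t).
Proof.
move=> fs; apply: (@nured_coind _ _ (fun a b => exists t f s,
  [/\ a = rename f t, b = subst s t & forall x, bisim (Var (f x)) (s x)]));
  last by exists t, f, s.
move=> {fs} {t f s} _ _ [t [f [s [-> -> fs]]]].
have up n x : bisim (Var (uprn n f x)) (upn n s x).
  rewrite /uprn /upn; case: ifP => // _.
  by rewrite (bisim_var (fs _)) renameE.
case: t => [x|c|r|a b|r ar bs]; rewrite !(renameE, substE) /=.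
- by rewrite (bisim_var (fs _)).
- by [].
- eexists; [by []|left]; by eexists _, _, _.
- by eexists _, _; split; [by []|left|left]; eexists _, f, s.
- eexists _, _; split; [by []|left|move=> k; left]; first by eexists _, f, s.
  by eexists _, _, _; split.
Qed.

Lemma bisim_subst t u s s' : bisim t u -> (forall x, bisim (s x) (s' x)) ->
  bisim (subst s t) (subst s' u).
Proof.
move=> tu fg; apply: (@nured_coind _ _ (fun a b => exists t u s s',
  [/\ a = subst s t, b = subst s' u, bisim t u &
     forall x, bisim (s x) (s' x)])); last by exists t, u, s, s'.
move=> {tu fg} {t u s s'} _ _ [t [u [f [g [-> -> tu fg]]]]].
have up n x : bisim (upn n f x) (upn n g x).
  by rewrite /upn; case: ifP => // _; apply: bisim_rename.
case: t tu => [x /bisim_var|c /bisim_con|r /bisim_lam|a b /bisim_app|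
  r ar bs /bisim_case].
- move->; rewrite !substE; apply: layer_mono (nured_unfold (fg x)) => //.
  by move=> ? ? ?; right.
- by move->; rewrite !substE.
- case=> r' -> h; rewrite !substE /=; eexists; [by []|left]; by eexists _, _, _, _.
- case=> a' [b' [-> h h']]; rewrite !substE /=; eexists _, _.
  by split; [by []|left|left]; eexists _, _, f, g.
- case=> r' [bs' [-> h h']]; rewrite !substE /=; eexists _, _.
  split; [by []|left|move=> k; left]; first by eexists _, _, f, g.
  by eexists _, _, _, _; split; [by []|by []|apply: h'|].
Qed.

Lemma subst_rename s f s' t : (forall x, bisim (s (f x)) (s' x)) ->
  bisim (subst s (rename f t)) (subst s' t).
Proof.
move=> fs; apply: (@nured_coind _ _ (fun a b => exists t s f s',
  [/\ a = subst s (rename f t), b = subst s' t &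
     forall x, bisim (s (f x)) (s' x)])); last by exists t, s, f, s'.
move=> {fs} {t f s s'} _ _ [t [s [f [s' [-> -> fs]]]]].
have up n x : bisim (upn n s (uprn n f x)) (upn n s' x).
  rewrite /uprn /upn; have [xn|_] := ltnP x n; first by rewrite xn.
  by rewrite ltnNge leq_addr addKn /=; apply: bisim_rename.
case: t => [x|c|r|a b|r ar bs]; rewrite !(renameE, substE) /=.
- by apply: layer_mono (nured_unfold (fs x)) => // ? ? ?; right.
- by [].
- eexists; [by []|left]; by eexists _, _, _, _.
- by eexists _, _; split; [by []|left|left]; eexists _, s, f, s'.
- eexists _, _; split; [by []|left|move=> k; left]; first by eexists _, s, f, s'.
  by eexists _, _, _, _; split.
Qed.

Lemma rename_rename f g h t : f \o g =1 h ->
  bisim (rename f (rename g t)) (rename h t).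
Proof.
(* The outer renaming is replaced by a substitution, so that [subst_rename] fuses the two. *)
move=> fgh; apply: bisim_trans (rename_subst _ (fun x => bisim_refl (Var (f x)))) _.
apply: bisim_trans (subst_rename _ (fun x => bisim_refl (Var (f (g x))))) _.
by apply/bisim_sym/rename_subst => x; rewrite -fgh.
Qed.

Lemma rename_subst_comp f s s' t : (forall x, bisim (rename f (s x)) (s' x)) ->
  bisim (rename f (subst s t)) (subst s' t).
Proof.
move=> fs; apply: (@nured_coind _ _ (fun a b => exists t f s s',
  [/\ a = rename f (subst s t), b = subst s' t &
     forall x, bisim (rename f (s x)) (s' x)])); last by exists t, f, s, s'.
move=> {fs} {t f s s'} _ _ [t [f [s [s' [-> -> fs]]]]].
have up n x : bisim (rename (uprn n f) (upn n s x)) (upn n s' x).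
  rewrite /upn; case: ifP => [xn|_]; first by rewrite renameE /uprn xn.
  apply: bisim_trans (bisim_rename (fs _) (frefl _)).
  apply: (@bisim_trans (rename (addn n \o f) (s (x - n)%N))).
    by apply: rename_rename => y /=; rewrite /uprn ltnNge leq_addr addKn.
  exact/bisim_sym/rename_rename.
case: t => [x|c|r|a b|r ar bs]; rewrite !(renameE, substE) /=.
- by apply: layer_mono (nured_unfold (fs x)) => // ? ? ?; right.
- by [].
- eexists; [by []|left]; by eexists _, _, _, _.
- by eexists _, _; split; [by []|left|left]; eexists _, f, s, s'.
- eexists _, _; split; [by []|left|move=> k; left]; first by eexists _, f, s, s'.
  by eexists _, _, _, _; split.
Qed.

(** Lifting a substitution under a binder renames its values, so this fusion law rests on the two
    mixed ones, [subst_rename] and [rename_subst_comp]. *)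
Lemma subst_subst s1 s2 s t : (forall x, bisim (subst s1 (s2 x)) (s x)) ->
  bisim (subst s1 (subst s2 t)) (subst s t).
Proof.
move=> fs; apply: (@nured_coind _ _ (fun a b => exists t s1 s2 s,
  [/\ a = subst s1 (subst s2 t), b = subst s t &
     forall x, bisim (subst s1 (s2 x)) (s x)])); last by exists t, s1, s2, s.
move=> {fs} {t s s1 s2} _ _ [t [s1 [s2 [s [-> -> fs]]]]].
have up n x : bisim (subst (upn n s1) (upn n s2 x)) (upn n s x).
  rewrite /upn; case: ifP => [xn|_]; first by rewrite substE /= xn.
  apply: bisim_trans (bisim_rename (fs _) (frefl _)).
  apply: (@bisim_trans (subst (rename (addn n) \o s1) (s2 (x - n)%N))).
    by apply: subst_rename => y /=; rewrite ltnNge leq_addr addKn.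
  by apply/bisim_sym/rename_subst_comp => y.
case: t => [x|c|r|a b|r ar bs]; rewrite !substE /=.
- by apply: layer_mono (nured_unfold (fs x)) => // ? ? ?; right.
- by [].
- eexists; [by []|left]; by eexists _, _, _, _.
- by eexists _, _; split; [by []|left|left]; eexists _, s1, s2, s.
- eexists _, _; split; [by []|left|move=> k; left]; first by eexists _, s1, s2, s.
  by eexists _, _, _, _; split.
Qed.

Lemma subst_id s t : (forall x, s x = Var x) -> bisim (subst s t) t.
Proof.
move=> fs; apply: (@nured_coind _ _ (fun a t => exists2 s,
  a = subst s t & forall x, s x = Var x)); last by exists s.
move=> {fs} {t s} _ t [s -> fs].
have up n x : upn n s x = Var x.
  rewrite /upn; case: ltnP => // nx; by rewrite fs renameE subnKC.
case: t => [x|c|r|a b|r ar bs]; rewrite !substE /=.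
- exact: fs.
- by [].
- eexists; [by []|left]; by eexists.
- by eexists _, _; split; [by []|left|left]; exists s.
- by eexists _, _; split; [by []|left|move=> k; left]; eexists.
Qed.

Lemma subst_var_id t : bisim (subst Var t) t.
Proof. exact: subst_id. Qed.

Lemma bisim_inst us us' t t' : size us = size us' ->
  (forall i, bisim (nth t us i) (nth t us' i)) -> bisim t t' ->
  bisim (inst us t) (inst us' t').
Proof.
move=> eus uus tt'; apply: bisim_subst => // x; rewrite eus.
have [xu|xu] := ltnP x (size us'); last by rewrite !nth_default ?eus.
(* Below the size the default of [nth] is immaterial, so the default [t] of the hypothesis can be
   exchanged for the one used by [inst]. *)
by have := uus x; rewrite !(@set_nth_default _ _ (Var (x - size us'))) ?eus.
Qed.

(** Both sides fuse to one simultaneous substitution; an index past [us] has its image shifted up by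
    the lifting and lowered again by [inst]. *)
Lemma subst_inst s us t :
  bisim (inst [seq subst s u | u <- us] (subst (upn (size us) s) t))
        (subst s (inst us t)).
Proof.
apply: (@bisim_trans (subst (fun x => subst s (nth (Var (x - size us)) us x)) t)).
  apply: subst_subst => x; rewrite /upn size_map.
  have [xu|xu] := ltnP x (size us).
    by rewrite substE (nth_map (Var (x - size us))).
  rewrite nth_default // substE.
  apply: bisim_trans (subst_var_id _).
  apply: subst_rename => y; rewrite addKn nth_default // size_map.
  exact: leq_addr.
by apply/bisim_sym/subst_subst => x.
Qed.

End Bisimilarity.

(** * Weak head reduction *)

Section WeakHeadReduction.
Context {C : choiceType}.
Implicit Types (c : C) (t u a b : term C) (us : seq (term C)) (s : nat -> term C).

Inductive wh : term C -> term C -> Prop :=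
| wh_beta t u : wh (App (Lam t) u) (inst [:: u] t)
| wh_iota (ar : {fmap C -> nat}) (bs : domf ar -> term C) (k : domf ar)
    (us : seq (term C)) :
    size us = ar k -> wh (Case (apps (Con (val k)) us) bs) (inst us (bs k))
| wh_app t t' u : wh t t' -> wh (App t u) (App t' u)
| wh_case t t' (ar : {fmap C -> nat}) (bs : domf ar -> term C) :
    wh t t' -> wh (Case t bs) (Case t' bs).

(** This form of the closure exposes the first step, which is where determinism compares two
    reductions. *)
Definition whs : term C -> term C -> Prop := clos_refl_trans_1n _ wh.

Lemma whs_refl t : whs t t.
Proof. exact: rt1n_refl. Qed.

Lemma whs_trans u t t' : whs t u -> whs u t' -> whs t t'.
Proof. by elim=> // x y z xy _ IH /IH; apply: Relation_Operators.rt1n_trans xy. Qed.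

Lemma whs_step t t' : wh t t' -> whs t t'.
Proof. by move=> h; apply: Relation_Operators.rt1n_trans h (whs_refl _). Qed.

Lemma whs_app t t' u : whs t t' -> whs (App t u) (App t' u).
Proof.
by elim=> [*|x y z xy _ IH]; [apply: whs_refl|apply: Relation_Operators.rt1n_trans IH; apply: wh_app].
Qed.

Lemma whs_case t t' (ar : {fmap C -> nat}) (bs : domf ar -> term C) :
  whs t t' -> whs (Case t bs) (Case t' bs).
Proof.
by elim=> [*|x y z xy _ IH]; [apply: whs_refl|apply: Relation_Operators.rt1n_trans IH; apply: wh_case].
Qed.

Lemma wh_steps t t' : wh t t' -> step t t'.
Proof.
elim=> *; [exact: step_beta|exact: step_iota|exact: step_appl|exact: step_case].
Qed.

Lemma whs_steps t t' : whs t t' -> steps t t'.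
Proof.
elim=> [x|x y z /wh_steps xy _ IH]; first exact: rt_refl.
by apply: rt_trans IH; apply: rt_step.
Qed.

Lemma apps_rcons t us u : apps t (rcons us u) = App (apps t us) u.
Proof. by rewrite /apps foldl_rcons. Qed.

Lemma apps_inj c c' us us' :
  apps (Con c) us = apps (Con c') us' -> c = c' /\ us = us'.
Proof.
elim/last_ind: us us' => [|us u IH] us'; elim/last_ind: us' => [|us' u' _];
  rewrite ?apps_rcons //=; first by case.
by case=> /IH[-> ->] ->.
Qed.

Lemma wh_inv t t' : wh t t' ->
  match t with
  | App a u => (exists2 r, a = Lam r & t' = inst [:: u] r) \/
               (exists2 a', wh a a' & t' = App a' u)
  | Case r ar bs =>
      (exists k us, [/\ size us = ar k, r = apps (Con (val k)) us &
                       t' = inst us (bs k)]) \/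
      (exists2 r', wh r r' & t' = Case r' bs)
  | _ => False
  end.
Proof.
case=> [r u|ar bs k us e|a a' u aa'|r r' ar bs rr'].
- by left; exists r.
- by left; exists k, us.
- by right; exists a'.
- by right; exists r'.
Qed.

Lemma wh_apps c us t : ~ wh (apps (Con c) us) t.
Proof.
elim/last_ind: us t => [|us u IH] t; first by move/wh_inv.
rewrite apps_rcons => /wh_inv[[r + _]|[a' /IH]//].
by case/lastP: us {IH} => [|us x] //; rewrite apps_rcons.
Qed.

Lemma whs_inv t t' : whs t t' -> t = t' \/ exists2 u, wh t u & whs u t'.
Proof. by case=> [|u v tu uv]; [left|right; exists u]. Qed.

Lemma whs_apps c us t : whs (apps (Con c) us) t -> t = apps (Con c) us.
Proof. by case/whs_inv => [//|[u /wh_apps]]. Qed.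

(** A contraction and a congruence never compete: abstractions and constructor spines have no weak
    head step. For a iota redex, [apps_inj] fixes the branch and the arguments. *)
Lemma wh_det t a b : wh t a -> wh t b -> a = b.
Proof.
move=> h; elim: h b => {t a} [r u|ar bs k us e|a a' u aa' IH|r r' ar bs rr' IH]
  b /wh_inv [].
- by case=> r' [->] ->.
- by case=> a' /wh_inv.
- by case=> k' [us' [_ /apps_inj[/val_inj<- <-] ->]].
- by case=> r' /wh_apps.
- by case=> r e; move: aa'; rewrite e => /wh_inv.
- by case=> b' /IH -> ->.
- by case=> k [us [_ e _]]; move: rr'; rewrite e => /wh_apps.
- by case=> b' /IH -> ->.
Qed.

Lemma whs_apps_det t u c us :
  whs t u -> whs t (apps (Con c) us) -> whs u (apps (Con c) us).
Proof.
elim=> // x y z xy _ IH /whs_inv[e|[y' /(wh_det xy) <- //]].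
by move: xy; rewrite e => /wh_apps.
Qed.

(** The spine is finite, so induction along it recovers the head constructor and the number of
    arguments exactly; only the arguments stay up to bisimilarity. *)
Lemma bisim_apps c us s a : bisim a (subst s (apps (Con c) us)) ->
  exists us', [/\ a = apps (Con c) us', size us' = size us &
    forall i t, bisim (nth t us' i) (nth t [seq subst s u | u <- us] i)].
Proof.
elim/last_ind: us a => [|us u IH] a.
  rewrite substE => /bisim_sym/bisim_con ->; exists [::].
  by split=> // i t; rewrite nth_nil; apply: bisim_refl.
rewrite apps_rcons substE => /bisim_sym/bisim_app[d [e [-> /bisim_sym]]].
move/IH=> [us' [-> es h]] /bisim_sym h'; exists (rcons us' e).
split; rewrite ?apps_rcons ?size_rcons ?es // => i t.
rewrite map_rcons !nth_rcons size_map es.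
by case: ifP => // _; case: ifP => // _; apply: bisim_refl.
Qed.

(** Taking [s = Var] says that bisimilarity is a simulation for [wh]. *)
Lemma wh_sim t t' s a : wh t t' -> bisim a (subst s t) ->
  exists2 a', wh a a' & bisim a' (subst s t').
Proof.
move=> h; elim: h s a => {t t'}
  [r u|ar bs k us e|t t' u tt' IH|r r' ar bs rr' IH] s a;
  rewrite substE => /bisim_sym.
- rewrite substE => /bisim_app[l [u' [-> /bisim_lam[r' -> rr'] uu']]].
  exists (inst [:: u'] r'); first exact: wh_beta.
  apply: bisim_trans (subst_inst _ _ _).
  apply: bisim_inst => //=; last exact: bisim_sym.
  by case=> [|i] /=; [exact: bisim_sym|rewrite !nth_nil; exact: bisim_refl].
- move=> /bisim_case[h' [bs' [-> /bisim_sym/bisim_apps[us' [-> es h]] hb]]].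
  exists (inst us' (bs' k)); first by apply: wh_iota; rewrite es.
  apply: bisim_trans (subst_inst _ _ _).
  apply: bisim_inst; rewrite ?size_map // e.
  exact/bisim_sym/hb.
- move=> /bisim_app[l [u' [-> /bisim_sym/IH[l' ll' h] uu']]].
  exists (App l' u'); first exact: wh_app.
  rewrite substE; apply: nured_fold => /=; eexists _, _; split=> //.
  exact: bisim_sym.
- move=> /bisim_case[l [bs' [-> /bisim_sym/IH[l' ll' h] uu']]].
  exists (Case l' bs'); first exact: wh_case.
  rewrite substE; apply: nured_fold => /=; eexists _, _; split=> // k.
  exact/bisim_sym/uu'.
Qed.

Lemma whs_sim t t' s a : whs t t' -> bisim a (subst s t) ->
  exists2 a', whs a a' & bisim a' (subst s t').
Proof.
move=> h; elim: h a => [x|x y z xy _ IH] a h; first by exists a => //; exact: whs_refl.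
have [a' aa' /IH[a'' a'a'' h'']] := wh_sim xy h.
by exists a'' => //; apply: whs_trans a'a''; apply: whs_step.
Qed.

Lemma whs_bisim t t' a : whs t t' -> bisim a t ->
  exists2 a', whs a a' & bisim a' t'.
Proof.
move=> tt' h; have [|a' ? h'] := @whs_sim _ _ Var a tt'.
  exact/(bisim_trans h)/bisim_sym/subst_var_id.
by exists a' => //; apply: bisim_trans h' (subst_var_id _).
Qed.

Lemma whs_rename t t' f a : whs t t' -> bisim a (rename f t) ->
  exists2 a', whs a a' & bisim a' (rename f t').
Proof.
have E u : bisim (rename f u) (subst (Var \o f) u).
  by apply: rename_subst => x; apply: bisim_refl.
move=> tt' h; have [|a' ? h'] := @whs_sim _ _ (Var \o f) a tt'.
  exact/(bisim_trans h)/E.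
by exists a' => //; apply: bisim_trans h' (bisim_sym (E _)).
Qed.

End WeakHeadReduction.

(** * Standardization of infinitary reduction *)

Section Standardization.
Context {C : choiceType}.
Implicit Types (c : C) (t u a b : term C) (us : seq (term C)) (s : nat -> term C).

Definition sred : term C -> term C -> Prop := nured (@whs C).

Lemma sred_refl t : sred t t.
Proof. exact: nured_refl whs_refl _. Qed.

Lemma whs_sred t u t' : whs t u -> sred u t' -> sred t t'.
Proof. by apply: nured_trans_l => ? ? ?; apply: whs_trans. Qed.

(** Absorbs the bisimilarities that the simulation lemmas leave on the source of a reduction. *)
Lemma bisim_sred a t b : bisim a t -> sred t b -> sred a b.
Proof.
move=> h h'.
apply: (@nured_coind _ _ (fun a b => exists2 t, bisim a t & sred t b));
  last by exists t.
move=> {h h'} {a t b} a b [t h /nured_unfold].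
case: b => [x|c|r'|b b'|r' ar bs'] /=.
- by move=> /whs_bisim /(_ h)[a' ? /bisim_sym/bisim_var <-].
- by move=> /whs_bisim /(_ h)[a' ? /bisim_sym/bisim_con <-].
- case=> r /whs_bisim /(_ h)[a' st /bisim_sym/bisim_lam[r0 e rr0] rr'].
  exists r0; first by rewrite -e.
  by left; exists r => //; apply: bisim_sym.
- case=> d [e [/whs_bisim /(_ h)[a' st /bisim_sym/bisim_app[r0 [r1 [e' h0 h1]]]] h2 h3]].
  exists r0, r1; rewrite -e'; split; [by []|left|left].
    by exists d => //; apply: bisim_sym.
  by exists e => //; apply: bisim_sym.
- case=> d [e [/whs_bisim /(_ h)[a' st /bisim_sym/bisim_case[r0 [r1 [e' h0 h1]]]] h2 h3]].
  exists r0, r1; rewrite -e'; split; [by []|left|move=> k; left].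
    by exists d => //; apply: bisim_sym.
  by exists (e k); [apply/bisim_sym/h1|apply: h3].
Qed.

Lemma sred_rename f t t' : sred t t' -> sred (rename f t) (rename f t').
Proof.
move=> h'.
(* The source is only bisimilar to [rename f t], because [whs_rename] recovers reducts up to
   bisimilarity. *)
apply: (@nured_coind _ _ (fun a b => exists f t t',
  [/\ bisim a (rename f t), b = rename f t' & sred t t']));
  last by exists f, t, t'; split=> //; apply: bisim_refl.
move=> {h'} {f t t'} a _ [f [t [t' [h -> /nured_unfold]]]].
case: t' => [x|c|r'|b b'|r' ar bs']; rewrite renameE /=.
- by move=> /whs_rename /(_ h)[a' ?]; rewrite renameE => /bisim_sym/bisim_var <-.
- by move=> /whs_rename /(_ h)[a' ?]; rewrite renameE => /bisim_sym/bisim_con <-.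
- case=> r /whs_rename /(_ h)[a' st].
  rewrite renameE => /bisim_sym/bisim_lam[r0 e rr0] rr'.
  exists r0; first by rewrite -e.
  by left; eexists _, r, r'; split=> //; apply: bisim_sym.
- case=> d [e [/whs_rename /(_ h)[a' st]]].
  rewrite renameE => /bisim_sym/bisim_app[r0 [r1 [e' h0 h1]]] h2 h3.
  exists r0, r1; rewrite -e'; split; [by []|left|left].
    by exists f, d, b; split=> //; apply: bisim_sym.
  by exists f, e, b'; split=> //; apply: bisim_sym.
- case=> d [e [/whs_rename /(_ h)[a' st]]].
  rewrite renameE => /bisim_sym/bisim_case[r0 [r1 [e' h0 h1]]] h2 h3.
  exists r0, r1; rewrite -e'; split; [by []|left|move=> k; left].
    by exists f, d, r'; split=> //; apply: bisim_sym.
  exists (uprn (ar k) f), (e k), (bs' k).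
  by split; [exact/bisim_sym/h1|by []|exact: h3].
Qed.

Lemma sred_subst s s' t t' : sred t t' -> (forall x, sred (s x) (s' x)) ->
  sred (subst s t) (subst s' t').
Proof.
move=> h' hs.
apply: (@nured_coind _ _ (fun a b => exists s s' t t',
  [/\ bisim a (subst s t), b = subst s' t', sred t t' &
     forall x, sred (s x) (s' x)]));
  last by exists s, s', t, t'; split=> //; apply: bisim_refl.
move=> {h' hs} {s s' t t'} a _ [s [s' [t [t' [h -> /nured_unfold ht hs]]]]].
have up n x : sred (upn n s x) (upn n s' x).
  by rewrite /upn; case: ifP => _; [apply: sred_refl|apply: sred_rename].
case: t' ht => [x|c|r'|b b'|r' ar bs']; rewrite substE /=.
(* Once the variable is exposed, the standard reduction from [s x] to [s' x] takes over. *)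
- move=> /whs_sim /(_ h)[a' aa']; rewrite substE => h'.
  have /nured_unfold := whs_sred aa' (bisim_sred h' (hs x)).
  by apply: layer_mono => // ? ? ?; right.
- by move=> /whs_sim /(_ h)[a' ?]; rewrite substE => /bisim_sym/bisim_con <-.
- case=> r /whs_sim /(_ h)[a' st].
  rewrite substE => /bisim_sym/bisim_lam[r0 e rr0] rr'.
  exists r0; first by rewrite -e.
  left; exists (upn 1 s), (upn 1 s'), r, r'.
  by split; [exact: bisim_sym|by []|by []|move=> x; exact: up].
- case=> d [e [/whs_sim /(_ h)[a' st]]].
  rewrite substE => /bisim_sym/bisim_app[r0 [r1 [e' h0 h1]]] h2 h3.
  exists r0, r1; rewrite -e'; split; [by []|left|left].
    by exists s, s', d, b; split=> //; apply: bisim_sym.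
  by exists s, s', e, b'; split=> //; apply: bisim_sym.
- case=> d [e [/whs_sim /(_ h)[a' st]]].
  rewrite substE => /bisim_sym/bisim_case[r0 [r1 [e' h0 h1]]] h2 h3.
  exists r0, r1; rewrite -e'; split; [by []|left|move=> k; left].
    by exists s, s', d, r'; split=> //; apply: bisim_sym.
  exists (upn (ar k) s), (upn (ar k) s'), (e k), (bs' k).
  split; [exact/bisim_sym/h1|by []|exact: h3|move=> x; exact: up].
Qed.

(** Each application on the spine has its own weak head reduction; since [wh] enters function
    positions, they concatenate into one reduction of the whole term. *)
Lemma sred_apps t c us : sred t (apps (Con c) us) -> exists us',
  [/\ whs t (apps (Con c) us'), size us' = size us &
      forall i d, sred (nth d us' i) (nth d us i)].
Proof.
elim/last_ind: us t => [|us u IH] t.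
  move/nured_unfold => /= h; exists [::]; split=> // i d.
  by rewrite nth_nil; apply: sred_refl.
rewrite apps_rcons => /nured_unfold[a [b [tab /IH[us' [aus' es h]] bu]]].
exists (rcons us' b); rewrite apps_rcons !size_rcons es; split=> //.
  by apply: whs_trans tab _; apply: whs_app.
move=> i d; rewrite !nth_rcons es.
by case: ifP => // _; case: ifP => // _; apply: sred_refl.
Qed.

Lemma sred_inst us us' t t' : size us = size us' ->
  (forall i d, sred (nth d us i) (nth d us' i)) -> sred t t' ->
  sred (inst us t) (inst us' t').
Proof. by move=> es h tt'; apply: sred_subst => // x; rewrite es. Qed.

(** The heart of standardization. A root redex is exposed by weak head steps, and [sred_inst] moves
    the reductions of its parts past the contraction; a deeper step is absorbed in the component
    where it occurs. *)
Lemma sred_step t t' t'' : sred t t' -> step t' t'' -> sred t t''.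
Proof.
move=> h st; elim: st t h => {t' t''}
  [r u|ar bs k us e|r r' _ IH|a a' u _ IH|a u u' _ IH|r r' ar bs _ IH|
   r ar bs bs' k _ IH eb] t /nured_unfold /=.
- case=> a [b [tab /nured_unfold[r0 ar0 rr0] bu]].
  have tb : whs t (inst [:: b] r0).
    apply: whs_trans tab _.
    exact: whs_trans (whs_app _ ar0) (whs_step (wh_beta _ _)).
  apply: whs_sred tb (sred_inst _ _ rr0) => //.
  by move=> [|i] d //=; rewrite !nth_nil; exact: sred_refl.
- case=> h [bs0 [th /sred_apps[us' [hus es hu]] hb]].
  apply: whs_sred (sred_inst es hu (hb k)).
  apply: whs_trans th _; apply: whs_trans (whs_case _ hus) (whs_step _).
  by apply: wh_iota; rewrite es.
- by case=> r0 tr /IH h; apply: nured_fold => /=; exists r0.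
- by case=> a0 [b [tab /IH h h']]; apply: nured_fold => /=; exists a0, b.
- by case=> a0 [b [tab h /IH h']]; apply: nured_fold => /=; exists a0, b.
- by case=> r0 [bs0 [tr /IH h h']]; apply: nured_fold => /=; exists r0, bs0.
- case=> r0 [bs0 [tr h h']]; apply: nured_fold => /=; exists r0, bs0; split=> // j.
  by have [->|/eb ->] := eqVneq j k; [apply: IH|]; apply: h'.
Qed.

Lemma sred_steps t t' t'' : sred t t' -> steps t' t'' -> sred t t''.
Proof.
move=> h st; elim: st t h => [x y xy|//|x y z _ IH1 _ IH2] t h.
  exact: sred_step xy.
exact/IH2/IH1.
Qed.

(** The finitary reduction at the root of each layer is absorbed by [sred_steps], and the components
    are again pairs of the same kind. *)
Lemma sred_infred_trans t u t' : sred t u -> infred u t' -> sred t t'.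
Proof.
move=> h h'.
apply: (@nured_coind _ _ (fun t t' => exists2 u, sred t u & infred u t'));
  last by exists u.
move=> {h h'} {t u t'} t t' [u tu /infred_layer].
case: t' => [x|c|r'|b b'|r' ar bs'] /=.
- by move=> /(sred_steps tu)/nured_unfold.
- by move=> /(sred_steps tu)/nured_unfold.
- case=> r /(sred_steps tu)/nured_unfold[r0 h h'] h''; exists r0 => //.
  by left; exists r.
- case=> d [e [/(sred_steps tu)/nured_unfold[r0 [r1 [h h' h'']] h1 h2]]].
  by exists r0, r1; split; [by []|left; exists d|left; exists e].
- case=> d [e [/(sred_steps tu)/nured_unfold[r0 [r1 [h h' h'']] h1 h2]]].
  exists r0, r1; split; [by []|by left; exists d|move=> k; left].
  by exists (e k); [apply: h''|apply: h2].
Qed.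

(** A reduction appended to the trivial standard one becomes standard; conversely, weak head steps
    are ordinary steps. This is the standardization theorem. *)
Lemma infred_sred t t' : infred t t' <-> sred t t'.
Proof.
split=> [|h]; first exact/sred_infred_trans/sred_refl.
apply: (@infred_coind _ sred) h => a b /nured_unfold.
by apply: layer_mono => // ?; apply: whs_steps.
Qed.

Lemma infred_refl t : infred t t.
Proof. exact/infred_sred/sred_refl. Qed.

Lemma infred_trans u t t' : infred t u -> infred u t' -> infred t t'.
Proof. by move=> /infred_sred tu ut'; apply/infred_sred/(sred_infred_trans tu). Qed.

Lemma infred_appl t t' u : infred t t' -> infred (App t u) (App t' u).
Proof. by move=> h; apply: infred_app (infred_refl u); [apply: rt_refl|]. Qed.

Lemma infred_whs_apps t c us : infred t (apps (Con c) us) -> exists us',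
  [/\ whs t (apps (Con c) us'), size us' = size us &
      forall i d, infred (nth d us' i) (nth d us i)].
Proof.
by move=> /infred_sred/sred_apps[us' [h e h']]; exists us'; split=> // i d;
  apply/infred_sred/h'.
Qed.

End Standardization.

(** * The canonical reduct of a term *)

Section ConstructorNormalForm.
Context {C : choiceType}.
Implicit Types (c : C) (w u : term C) (us : seq (term C)).

Definition con_headed w : Prop := exists c us, whs w (apps (Con c) us).

(** The reduct is picked by classical choice; determinism of [wh] makes the choice the only possible
    one, see [con_whnfE]. *)
Definition con_whnf w : term C :=
  if pselect (con_headed w) is left h then
    let: exist c h' := cid h in apps (Con c) (sval (cid h'))
  else w.

(** The function part [a] of a constructor spine is itself a constructor spine, so the same
    corecursion serves for walking down the spine and for entering the arguments. *)
CoFixpoint nf w : term C :=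
  if `[<con_headed w>] then
    match con_whnf w with
    | App a b => App (nf a) (nf b)
    | u => u
    end
  else w.

Lemma con_whnfE w c us :
  whs w (apps (Con c) us) -> con_whnf w = apps (Con c) us.
Proof.
move=> h; rewrite /con_whnf; case: pselect => [hw|]; last by case; exists c, us.
case: cid => c' h'; case: cid => us' /= /(whs_apps_det h) h''.
by rewrite (whs_apps h'').
Qed.

Lemma nf_apps w c us :
  whs w (apps (Con c) us) -> nf w = apps (Con c) [seq nf u | u <- us].
Proof.
elim/last_ind: us w => [|us u IH] w h;
  rewrite [nf w]termE /= asboolT; try by [exists c; eexists; exact: h].
  by rewrite (con_whnfE h).
rewrite (con_whnfE h) map_rcons !apps_rcons (IH (apps (Con c) us)) //.
exact: whs_refl.
Qed.

Lemma nf_id w : ~ con_headed w -> nf w = w.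
Proof. by move=> h; rewrite [LHS]termE /= asboolF //; case: w h. Qed.

Lemma nf_app w u : con_headed w -> nf (App w u) = App (nf w) (nf u).
Proof.
move=> [c [us h]]; rewrite (nf_apps h) (@nf_apps _ c (rcons us u)).
  by rewrite map_rcons apps_rcons.
by rewrite apps_rcons; apply: whs_app.
Qed.

Lemma infred_nf w : infred w (nf w).
Proof.
apply/infred_sred.
apply: (@nured_coind _ _ (fun w u => u = nf w)) => // {}w _ ->.
have [[c [us h]]|h] := pselect (con_headed w); last first.
  rewrite nf_id //; apply: layer_mono (nured_unfold (sred_refl w)) => //.
  by move=> ? ? ?; right.
rewrite (nf_apps h); case/lastP: us h => [|us u] h //.
(* The shorter spine [apps (Con c) us] is its own head reduct, which puts the function parts back
   into the graph of [nf]. *)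
rewrite map_rcons apps_rcons /=; exists (apps (Con c) us), u.
rewrite -apps_rcons; split=> //; left=> //.
by rewrite (nf_apps (whs_refl _)).
Qed.

Definition nf_closed (X : set (term C)) : Prop :=
  forall w u, infred w u -> X u -> X (nf w).

End ConstructorNormalForm.

Local Open Scope order_scope.

(** * Comparison of transfinite iterates *)

Section Iterates.
Context {disp : Order.disp_t} {Om : tbOrderType disp}.
Context (wf : well_founded (fun x y : Om => x < y)) {T : Type}.
Implicit Types (F G : set T -> set T) (X : set T) (k : Om).

(** The hypothesis merges monotonicity with a comparison of operators, as one definition under two
    environments yields two operators. *)
Lemma iter_up_mono F G k : (forall X Y, X `<=` Y -> F X `<=` G Y) ->
  iter_up wf F k `<=` iter_up wf G k.
Proof.
move=> FG; elim/(well_founded_ind wf): k => k IH t; rewrite !iter_upE /=.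
move=> [[l [h [e Ft]]]|[kl [l [h Ft]]]]; [left|right].
  by exists l, h; split=> //; apply: FG Ft; apply: IH.
by split=> //; exists l, h; apply: IH.
Qed.

Lemma iter_down_mono F G k : (forall X Y, X `<=` Y -> F X `<=` G Y) ->
  iter_down wf F k `<=` iter_down wf G k.
Proof.
move=> FG; elim/(well_founded_ind wf): k => k IH t; rewrite !iter_downE /=.
move=> [h1 h2]; split=> [l h e|kl l h].
  by apply: FG (h1 l h e); apply: IH.
by apply: IH => //; apply: h2.
Qed.

Lemma iter_down_post F X k : monotone F -> X `<=` F X -> X `<=` iter_down wf F k.
Proof.
move=> Fm XF; elim/(well_founded_ind wf): k => k IH t Xt.
rewrite iter_downE /=; split=> [l h e|_ l h]; last exact: IH.
by apply: (Fm X); [apply: IH|apply: XF].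
Qed.

End Iterates.

(** * Induction on definitions; environments *)

Section Semantics.
Context {C : choiceType} (D : def_system C) {disp : Order.disp_t}
  (Om : sizeOrdinals (term C) disp).
Implicit Types (d : D) (tau : ty D) (xi : tenv C) (v : senv Om) (k : Om)
  (X : set (term C)).

Local Notation carg d i l := (@ctor_arg _ _ _ (def d) i l).

(** Semantic properties are proved in two tiers: by induction on a type, assuming them for the
    definitions that occur in it, and then for all definitions by this principle. *)
Lemma def_system_ind (P : D -> Prop) :
  (forall d, (forall i (l : 'I_(nargs i)) d',
     def_in d' (carg d i l) -> P d') -> P d) ->
  forall d, P d.
Proof.
move=> H; apply: (well_founded_ind (@def_lt_wf _ D)) => d IH.
by apply: H => i l d' /ctor_arg_defs; apply: IH.
Qed.

Lemma upds_mem xi xi' n (Bs : n.-tuple nat) Y A :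
  A \in Bs -> upds xi Bs Y A = upds xi' Bs Y A.
Proof.
move=> /tnthP[j e]; rewrite /upds; case: pickP => // /(_ j).
by rewrite e eqxx.
Qed.

Lemma upds_sub xi xi' n (Bs : n.-tuple nat) Y Y' :
  (forall A, xi A `<=` xi' A) -> (forall j, Y j `<=` Y' j) ->
  forall A, upds xi Bs Y A `<=` upds xi' Bs Y' A.
Proof. by move=> h h' A; rewrite /upds; case: pickP. Qed.

Lemma upd_sub xi xi' A X X' : (forall B, xi B `<=` xi' B) -> X `<=` X' ->
  forall B, upd xi A X B `<=` upd xi' A X' B.
Proof. by move=> h h' B; rewrite /upd; case: ifP. Qed.

(** * Dependence on type variables *)

Section TypeVariables.

Let def_ext d : Prop := forall k xi xi' v,
  (forall A, A \in params (def d) -> xi A = xi' A) ->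
  def_sem d k xi v = def_sem d k xi' v.

Let eq_ty_sem_def tau : (forall d, def_in d tau -> def_ext d) ->
  forall xi xi' v, (forall A, tvar_in A tau -> xi A = xi' A) ->
  ty_sem tau xi v = ty_sem tau xi' v.
Proof.
elim: tau => [A|d s args IH|t1 IH1 t2 IH2|i t IH] H xi xi' v e.
- exact: e.
- rewrite !ty_sem_data /data_sem.
  have -> : (fun j => ty_sem (args j) xi v) = (fun j => ty_sem (args j) xi' v).
    apply: funext => j; apply: IH => [d' d'in|A Ain].
      by apply: H; right; exists j.
    by apply: e; exists j.
  by apply: H; [left|move=> A; apply: upds_mem].
- rewrite /ty_sem /=.
  rewrite -!/(ty_sem _ _ _) (IH1 _ xi xi').
  rewrite (IH2 _ xi xi') //.
  + by move=> d ?; apply: H; right.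
  + by move=> A ?; apply: e; right.
  + by move=> d ?; apply: H; left.
  + by move=> A ?; apply: e; left.
- rewrite /ty_sem /=; apply/seteqP; split=> t' /= h k;
    have [t'' [r h']] := h k; exists t''; split=> //; move: h';
    rewrite -!/(ty_sem _ _ _).
  + by rewrite (IH _ xi xi').
  + by rewrite (IH _ xi' xi) // => A ?; rewrite e.
Qed.

Lemma eq_def_sem d k xi xi' v :
  (forall A, A \in params (def d) -> xi A = xi' A) ->
  def_sem d k xi v = def_sem d k xi' v.
Proof.
move: d k xi xi' v; apply: (@def_system_ind def_ext) => d IH k xi xi' v e.
rewrite !def_semE; congr iter_def; apply: funext => X.
have E i (l : 'I_(nargs i)) : ty_sem (carg d i l) (upd xi (rec_var (def d)) X) v
    = ty_sem (carg d i l) (upd xi' (rec_var (def d)) X) v.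
  apply: eq_ty_sem_def => [d'|A /ctor_arg_tvars]; first exact: IH.
  by rewrite inE /upd; case: eqP => //= _; apply: e.
apply/seteqP; split=> t [i [us [-> h]]]; exists i, us; split=> // l;
  move: (h l); by rewrite -!/(ty_sem _ _ _) E.
Qed.

Lemma eq_ty_sem tau xi xi' v : (forall A, tvar_in A tau -> xi A = xi' A) ->
  ty_sem tau xi v = ty_sem tau xi' v.
Proof. by apply: eq_ty_sem_def => d _; apply: eq_def_sem. Qed.

Lemma ty_closed_sem tau xi xi' v : ty_closed tau ->
  ty_sem tau xi v = ty_sem tau xi' v.
Proof. by move=> h; apply: eq_ty_sem => A /h. Qed.

End TypeVariables.

(** * Monotonicity in the environment *)

Section Monotonicity.

Let def_mono d : Prop := forall k xi xi' v,
  (forall A, xi A `<=` xi' A) -> def_sem d k xi v `<=` def_sem d k xi' v.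

(** In a type that is not closed, the domain of an arrow is closed and so ignores the environment;
    all other positions are covariant. *)
Let sub_ty_sem_def tau : strictly_positive tau ->
  (forall d, def_in d tau -> def_mono d) ->
  forall xi xi' v, (forall A, xi A `<=` xi' A) ->
  ty_sem tau xi v `<=` ty_sem tau xi' v.
Proof.
elim=> {tau} [tau cl|A|t1 t2 cl _ IH|i t _ IH|d args _ IH] H xi xi' v e.
- by rewrite (ty_closed_sem xi xi').
- exact: e.
- move=> t h r h'.
  have h1 : ty_sem t1 xi v r by rewrite (ty_closed_sem _ xi' v cl).
  have [t' [rt' {}h']] := h r h1.
  exists t'; split=> //; apply: IH h' => // d ?.
  by apply: H; right.
- move=> t' h k; have [t'' [r h']] := h k; exists t''; split=> //.
  exact: IH h'.
- rewrite !ty_sem_data /data_sem; apply: (H); first by left.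
  apply: upds_sub => // j; apply: IH => // d' ?.
  by apply: H; right; exists j.
Qed.

Let sub_Phi_def d : (forall i (l : 'I_(nargs i)) d',
     def_in d' (carg d i l) -> def_mono d') ->
  forall xi xi' v X X', (forall A, xi A `<=` xi' A) -> X `<=` X' ->
  Phi d xi v X `<=` Phi d xi' v X'.
Proof.
move=> IH xi xi' v X X' e XX' t [i [us [-> h]]]; exists i, us; split=> // l.
apply: sub_ty_sem_def (h l); first exact: ctor_arg_sp; first exact: IH.
exact: upd_sub.
Qed.

Lemma sub_def_sem d k xi xi' v : (forall A, xi A `<=` xi' A) ->
  def_sem d k xi v `<=` def_sem d k xi' v.
Proof.
move: d k xi xi' v; apply: (@def_system_ind def_mono) => d IH k xi xi' v e.
rewrite !def_semE /iter_def.
case: (kind _); [apply: iter_up_mono|apply: iter_down_mono] => X X' XX';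
  exact: sub_Phi_def.
Qed.

Lemma sub_ty_sem tau xi xi' v : strictly_positive tau ->
  (forall A, xi A `<=` xi' A) -> ty_sem tau xi v `<=` ty_sem tau xi' v.
Proof. by move=> sp; apply: sub_ty_sem_def => // d _; apply: sub_def_sem. Qed.

Lemma sub_Phi d xi xi' v X X' : (forall A, xi A `<=` xi' A) -> X `<=` X' ->
  Phi d xi v X `<=` Phi d xi' v X'.
Proof. by apply: sub_Phi_def => i l d' _; apply: sub_def_sem. Qed.

End Monotonicity.

(** * Normal forms in interpretations *)

Section NormalForms.

Definition nf_closed_env xi : Prop := forall A, nf_closed (xi A).

Lemma nf_closed_upd xi A X :
  nf_closed_env xi -> nf_closed X -> nf_closed_env (upd xi A X).
Proof. by move=> h h' B; rewrite /upd; case: ifP. Qed.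

Lemma nf_closed_upds xi n (Bs : n.-tuple nat) Y :
  nf_closed_env xi -> (forall j, nf_closed (Y j)) ->
  nf_closed_env (upds xi Bs Y).
Proof. by move=> h h' B; rewrite /upds; case: pickP. Qed.

Lemma iter_up_nf_closed (F : set (term C) -> set (term C)) k :
  (forall X, nf_closed X -> nf_closed (F X)) ->
  nf_closed (iter_up (@ords_wf _ _ Om) F k).
Proof.
move=> FH; elim/(well_founded_ind (@ords_wf _ _ Om)): k => k IH w u wu.
rewrite !iter_upE => -[[l [h [e Ft]]]|[kl [l [h Ft]]]]; [left|right].
  by exists l, h; split=> //; apply: FH Ft => //; apply: IH.
by split=> //; exists l, h; apply: IH Ft.
Qed.

Lemma iter_down_nf_closed (F : set (term C) -> set (term C)) k :
  (forall X, nf_closed X -> nf_closed (F X)) ->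
  nf_closed (iter_down (@ords_wf _ _ Om) F k).
Proof.
move=> FH; elim/(well_founded_ind (@ords_wf _ _ Om)): k => k IH w u wu.
rewrite !iter_downE => -[h1 h2]; split=> [l h e|kl l h].
  by apply: FH (h1 l h e) => //; apply: IH.
by apply: IH (h2 kl l h).
Qed.

Let def_nf d : Prop := forall k xi v,
  nf_closed_env xi -> nf_closed (def_sem d k xi v).

Let ty_sem_nf_closed_def tau : (forall d, def_in d tau -> def_nf d) ->
  forall xi v, nf_closed_env xi -> nf_closed (ty_sem tau xi v).
Proof.
elim: tau => [A|d s args IH|t1 IH1 t2 IH2|i t IH] H xi v nfxi.
- exact: nfxi.
- rewrite ty_sem_data; apply: (H); first by left.
  apply: nf_closed_upds => // j; apply: IH => // d' ?.
  by apply: H; right; exists j.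
- move=> w u wu h r /h[t' [urt' h']].
  have wrt' : infred (App w r) t' by apply: infred_trans urt'; apply: infred_appl.
  exists (nf (App w r)); split; last first.
    by apply: IH2 wrt' h' => // d ?; apply: H; right.
  (* The witness has to be reached from [App (nf w) r]: either [nf] distributes over the
     application, or [nf w] is [w]. *)
  have [hw|hw] := pselect (con_headed w); last first.
    by rewrite (nf_id hw); apply: infred_nf.
  rewrite nf_app //; apply: infred_app (infred_refl _) (infred_nf _).
  exact: rt_refl.
- move=> w u wu h k; have [t' [ut' h']] := h k.
  exists (nf w); split; first exact: infred_refl.
  by apply: IH h' => //; apply: infred_trans wu ut'.
Qed.

Let Phi_nf_closed_def d : (forall i (l : 'I_(nargs i)) d',
     def_in d' (carg d i l) -> def_nf d') ->
  forall xi v X, nf_closed_env xi -> nf_closed X -> nf_closed (Phi d xi v X).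
Proof.
move=> IH xi v X nfxi nfX w u wu [i [us [e h]]].
have := wu; rewrite e => /infred_whs_apps[ws [hw es hu]].
have sz : size ws == nargs i by rewrite es size_tuple.
exists i, (map_tuple nf (Tuple sz)); split; first exact: nf_apps.
move=> l; rewrite tnth_map; apply: ty_sem_nf_closed_def (h l).
- exact: IH.
- exact: nf_closed_upd.
(* The default is arbitrary, since [l] lies within both tuples. *)
- have := hu l (Con (ctor i)).
  by rewrite -!(tnth_nth _ (Tuple sz)) -(tnth_nth _ us).
Qed.

Lemma def_sem_nf_closed d k xi v :
  nf_closed_env xi -> nf_closed (def_sem d k xi v).
Proof.
move: d k xi v; apply: (@def_system_ind def_nf) => d IH k xi v nfxi.
rewrite def_semE /iter_def.
case: (kind _); [apply: iter_up_nf_closed|apply: iter_down_nf_closed] => X nfX;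
  exact: Phi_nf_closed_def.
Qed.

Lemma ty_sem_nf_closed tau xi v :
  nf_closed_env xi -> nf_closed (ty_sem tau xi v).
Proof. by apply: ty_sem_nf_closed_def => d _ k ? ?; apply: def_sem_nf_closed. Qed.

Lemma Phi_nf_closed d xi v X :
  nf_closed_env xi -> nf_closed X -> nf_closed (Phi d xi v X).
Proof.
by apply: Phi_nf_closed_def => i l d' _ k ? ?; apply: def_sem_nf_closed.
Qed.

End NormalForms.

(** * Commutation with countable intersections *)

Section Intersections.

Definition cap_env (xis : nat -> tenv C) : tenv C :=
  fun A => [set t | forall n, xis n A t].

(** Only the stage [\top] is considered: it is the one carried by data types in the clause
    [sp_data], and there the iterate is a fixpoint. *)
Let def_cap d : Prop := forall xis v,
  (forall n, nf_closed_env (xis n)) ->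
  forall t, (forall n, def_sem d (\top : Om) (xis n) v t) ->
  def_sem d (\top : Om) (cap_env xis) v t.

(** Arrows and size quantifiers supply a witness that depends on [n]; [ty_sem_nf_closed] replaces
    all of them by one normal form. *)
Let ty_sem_cap_def tau : strictly_positive tau ->
  (forall d, def_in d tau -> def_cap d) ->
  forall xis v, (forall n, nf_closed_env (xis n)) ->
  forall t, (forall n, ty_sem tau (xis n) v t) -> ty_sem tau (cap_env xis) v t.
Proof.
elim=> {tau} [tau cl|A|t1 t2 cl _ IH|i t1 _ IH|d args _ IH] H xis v nfx t h.
- by rewrite (ty_closed_sem _ (xis 0%N)).
- exact: h.
- move=> r h'; have hr n : ty_sem t1 (xis n) v r.
    by rewrite (ty_closed_sem _ (cap_env xis) v cl).
  exists (nf (App t r)); split; first exact: infred_nf.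
  apply: IH => // [d ?|n]; first by apply: H; right.
  have [t' [rt' ht']] := h n r (hr n).
  exact: ty_sem_nf_closed rt' ht'.
- move=> k; exists (nf t); split; first exact: infred_nf.
  apply: IH => // n; have [t' [tt' ht']] := h n k.
  exact: ty_sem_nf_closed tt' ht'.
- rewrite ty_sem_data /data_sem.
  have {}IH j u : (forall n, ty_sem (args j) (xis n) v u) ->
      ty_sem (args j) (cap_env xis) v u.
    by apply: IH => // d' ?; apply: H; right; exists j.
  pose Y n j := ty_sem (args j) (xis n) v.
  have Hd : def_cap d by apply: H; left.
  have nfY n : nf_closed_env (upds (xis n) (params (def d)) (Y n)).
    by apply: nf_closed_upds => // j; apply: ty_sem_nf_closed.
  apply: sub_def_sem (Hd _ v nfY t h) => A u; rewrite /cap_env /upds /=.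
  by case: pickP => // j _; apply: IH.
Qed.

(** A term splits into a constructor and its arguments in only one way, so all indices [n] speak of
    the same arguments. *)
Let Phi_cap_def d : (forall i (l : 'I_(nargs i)) d',
     def_in d' (carg d i l) -> def_cap d') ->
  forall xis v Xs, (forall n, nf_closed_env (xis n)) ->
  (forall n, nf_closed (Xs n)) ->
  forall t, (forall n, Phi d (xis n) v (Xs n) t) ->
  Phi d (cap_env xis) v [set t | forall n, Xs n t] t.
Proof.
move=> IH xis v Xs nfx nfX t h; have [i [us [et _]]] := h 0%N.
exists i, us; split=> // l.
pose xis' n := upd (xis n) (rec_var (def d)) (Xs n).
have nfx' n : nf_closed_env (xis' n) by apply: nf_closed_upd.
have /sub_ty_sem : forall A, cap_env xis' A `<=`
    upd (cap_env xis) (rec_var (def d)) [set t | forall n, Xs n t] A.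
  by move=> A u; rewrite /cap_env /xis' /upd /=; case: ifP.
apply; first exact: ctor_arg_sp.
apply: ty_sem_cap_def => // [|d'|n]; [exact: ctor_arg_sp|exact: IH|].
have [i' [us' [et' h']]] := h n.
move: et'; rewrite et => /apps_inj[/ctor_inj ei]; subst i'.
by move/val_inj => eu; subst us'; exact: h'.
Qed.

(** For a coinductive definition the intersection of the fixpoints is a post-fixpoint. For an
    inductive one, induction runs on the stage at which the term enters the first fixpoint. *)
Lemma def_sem_cap d : def_cap d.
Proof.
move: d; apply: def_system_ind => d IH xis v nfx t.
have Phim xi : monotone (Phi d xi v) by move=> X X'; apply: sub_Phi => A.
pose I xi := iter_def (Om := Om) d (Phi d xi v).
have nfI n k : nf_closed (I (xis n) k).
  by rewrite /I -def_semE; apply: def_sem_nf_closed.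
have IF xi : Phi d xi v (I xi \top) = I xi \top.
  have [[up _] [down _]] := @ords_large _ _ Om _ (Phim xi).
  by rewrite /I /iter_def; case: kind.
rewrite def_semE -/(I _).
have -> : (forall n, def_sem d (\top : Om) (xis n) v t) =
    (forall n, I (xis n) \top t).
  by apply: eq_forall => n; rewrite def_semE.
case ek : (kind (def d)); last first.
  move=> h; rewrite /I /iter_def ek.
  apply: (@iter_down_post _ _ _ _ _ [set t | forall n, I (xis n) \top t]) => //.
  move=> u hu; apply: Phi_cap_def => // n; rewrite IF; exact: hu.
move=> h; have : I (xis 0%N) \top t by [].
(* Only the membership for index [0] gets a variable stage; [h] keeps all the memberships at
   [\top]. *)
move: t h; move: {2}(\top : Om) => k; rewrite {2}/I /iter_def ek.
elim/(well_founded_ind (@ords_wf _ _ Om)): k => k IHk t h.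
rewrite iter_upE => -[[l [lk [_ Ft]]]|[_ [l [lk Ft]]]]; last exact: IHk Ft.
(* The term is decomposed both in the stage [l] of the first fixpoint, for
   the induction, and in all the fixpoints themselves. *)
pose xis' n := xis n.-1.
pose Xs n := if n is m.+1 then I (xis m) \top else I (xis 0%N) l.
(* The predecessor duplicates [xis 0] at index [0], and index [n.+1] stands for the former [n]. *)
have sub_cap A : cap_env xis' A `<=` cap_env xis A.
  by move=> u hu n; have := hu n.+1.
rewrite -IF; apply: (sub_Phi sub_cap) (Phi_cap_def (Xs := Xs) IH _ _ _).
- move=> u hu; apply: (IHk l) => // [n|]; first exact: (hu n.+1).
  by have := hu 0%N; rewrite /Xs /I /iter_def ek.
- by move=> n; apply: nfx.
- by case=> [|n]; apply: nfI.
- by case=> [|n]; rewrite /Xs /xis' /=; [rewrite /I /iter_def ek|rewrite IF].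
Qed.

Lemma Phi_cap d xis v Xs : (forall n, nf_closed_env (xis n)) ->
  (forall n, nf_closed (Xs n)) ->
  forall t, (forall n, Phi d (xis n) v (Xs n) t) ->
  Phi d (cap_env xis) v [set t | forall n, Xs n t] t.
Proof. by apply: Phi_cap_def => i l d' _; apply: def_sem_cap. Qed.

End Intersections.

End Semantics.

(** * From finite stages to the greatest fixpoint *)

Theorem theorem5p22 (C : choiceType) (D : def_system C) (disp : Order.disp_t)
    (Om : sizeOrdinals (term C) disp) (xi : tenv C) (v : senv Om)
    (d_nu : D) (alpha : 'I_(arity d_nu) -> ty D)
    (d_nu_coind : kind (def d_nu) = CoInd)
    (alpha_closed : forall j, ty_closed (alpha j))
    (alpha_sp : forall j, strictly_positive (alpha j))
    (t : term C)
    (t_approx : forall n : nat, exists t_n,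
       infred t t_n /\ data_sem alpha (onat n) xi v t_n) :
  exists t_inf, data_sem alpha Order.top xi v t_inf /\ infred t t_inf.
Proof.
(* The parameters are closed, so the arbitrary [xi] can be traded for an environment whose sets are
   trivially [nf_closed]. *)
pose xi0 : tenv C := fun=> setT.
pose e := upds xi0 (params (def d_nu)) (fun j => ty_sem (alpha j) xi0 v).
have E k : data_sem alpha k xi v = iter_down (@ords_wf _ _ Om) (Phi d_nu e v) k.
  rewrite /data_sem; transitivity (def_sem d_nu k e v).
    apply: eq_def_sem => A Ain; rewrite (upds_mem xi xi0 _ Ain) /e; congr upds.
    by apply: funext => j; apply: ty_closed_sem.
  by rewrite def_semE /iter_def d_nu_coind.
have nfe : nf_closed_env e.
  by apply: nf_closed_upds => // j; apply: ty_sem_nf_closed.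
have nfI k : nf_closed (iter_down (@ords_wf _ _ Om) (Phi d_nu e v) k).
  by apply: iter_down_nf_closed => X; apply: Phi_nf_closed.
have Ht n : iter_down (@ords_wf _ _ Om) (Phi d_nu e v) (onat n) (nf t).
  by have [t_n [tt_n]] := t_approx n; rewrite E; apply: nfI.
exists (nf t); split; last exact: infred_nf.
rewrite E.
(* The successor is capped: if a finite stage is already [\top], the claim is immediate; otherwise
   every [onat n] is below [\top] and [iter_downS] applies. *)
have [[n nT]|nT] := pselect (exists n, onat n = Order.top :> Om).
  by rewrite -nT.
pose X n := iter_down (@ords_wf _ _ Om) (Phi d_nu e v) (onat n).
(* A post-fixpoint lies below every stage, which jumps from the finite stages to [\top] without
   following the ordinals in between. *)
apply: (@iter_down_post _ _ _ _ _ [set u | forall n, X n u]) => //.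
  by move=> Y Z; apply: sub_Phi => A.
move=> u Xu.
(* [Phi_cap] intersects environments too; the sequence is constant here, and its intersection is
   included in [e]. *)
have /sub_Phi sub : forall A, cap_env (fun=> e) A `<=` e A by move=> A w /(_ 0%N).
suff : Phi d_nu (cap_env (fun=> e)) v [set u | forall n, X n u] u.
  exact: sub.
apply: Phi_cap => // n; first exact: nfI.
(* Shift by one: membership at stage [n.+1] is what gives [Phi] at stage [n]. *)
have := Xu n.+1; rewrite /X iter_downS //.
by rewrite lt_neqAle lex1 andbT; apply/eqP => en; apply: nT; exists n.
Qed.
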